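(* Let $X$ be a Cantor set. The set of topologically free homeomorphisms of $X$ is $\tau$-dense in $Homeo(X)$.
   Context: $X$ is a Cantor set and $Homeo(X)$ is the group of all homeomorphisms of $X$. For $S,T\in Homeo(X)$ put $E(S,T)=\{x\in X: Sx\ne Tx\}$. The (uniform) topology $\tau$ on $Homeo(X)$ has as a base the sets $$\{S\in Homeo(X):\mu_i(E(S,T))<\varepsilon,\ i=1,\ldots,n\},$$ where $T\in Homeo(X)$, $\mu_1,\ldots,\mu_n$ are Borel probability measures on $X$, and $\varepsilon>0$. A point $x$ is aperiodic for $T$ if $T^nx\ne x$ for all integers $n\ne0$. A homeomorphism $T$ is topologically free if the set of its aperiodic points is dense in $X$. *)

(* Defs.v *)
From HB Require Import structures.
From mathcomp Require Import all_boot all_order all_algebra.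
From mathcomp Require Import all_classical all_reals.
From mathcomp Require Import topology measure cantor.

Set Implicit Arguments.
Unset Strict Implicit.
Unset Printing Implicit Defensive.

Import Order.TTheory GRing.Theory Num.Theory.

Local Open Scope classical_set_scope.
Local Open Scope ring_scope.

Record homeomorphism (X Y : topologicalType) := Homeomorphism {
  homeo_fun :> X -> Y ;
  homeo_inv : Y -> X ;
  homeo_funK : cancel homeo_fun homeo_inv ;
  homeo_invK : cancel homeo_inv homeo_fun ;
  homeo_fun_continuous : continuous homeo_fun ;
  homeo_inv_continuous : continuous homeo_inv }.

Definition idhomeo (X : topologicalType) : homeomorphism X X :=
  @Homeomorphism X X id id (fun=> erefl) (fun=> erefl)
    (fun=> cvg_id) (fun=> cvg_id).

(* A Cantor set is a space homeomorphic to [cantor_space], i.e. to bool^nat.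
   It is nonempty, so nothing is lost by asking for a pointed type, which is
   what [g_sigma_algebraType] and [isBaseTopological] need. *)
HB.mixin Record isCantorSet X & Topological X := {
  cantor_setP : $| homeomorphism X cantor_space | }.

#[short(type="cantorSetType")]
HB.structure Definition CantorSet :=
  { X of isCantorSet X & PointedTopological X }.

HB.instance Definition _ :=
  isCantorSet.Build cantor_space (squash (idhomeo cantor_space)).

Section aperiodicity.
Variable X : topologicalType.
Implicit Types S T : homeomorphism X X.

Definition homeo_pow T (n : int) : X -> X :=
  match n with
  | Posz k => iter k T
  | Negz k => iter k.+1 (homeo_inv T)
  end.

Definition aperiodic T : set X :=
  [set x | forall n : int, n != 0 -> homeo_pow T n x != x].

Definition topologically_free T : Prop := dense (aperiodic T).

Definition differ S T : set X := [set x | S x != T x].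

Lemma differC S T : differ S T = differ T S.
Proof. by rewrite /differ; under eq_set do rewrite eq_sym. Qed.

Lemma differ_triangle S T U : differ S U `<=` differ S T `|` differ T U.
Proof.
by rewrite /differ => x /= SU; case: (eqVneq (S x) (T x)) => [<-|]; [right|left].
Qed.

Lemma differ_open S T : hausdorff_space X -> open (differ S T).
Proof.
rewrite open_hausdorff => hX; rewrite openE => x /hX[[U V] [/= Ux Vx] [oU oV UV0]].
rewrite inE in Ux; rewrite inE in Vx.
have US : nbhs x (S @^-1` U).
  by apply: homeo_fun_continuous; apply: open_nbhs_nbhs; split.
have VT : nbhs x (T @^-1` V).
  by apply: homeo_fun_continuous; apply: open_nbhs_nbhs; split.
apply: filterS (filterI US VT) => y [/= Uy Vy]; apply/eqP => e.
suff : (U `&` V) (S y) by move/eqP: UV0 => ->.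
by split => //; rewrite e.
Qed.

End aperiodicity.

Lemma cantor_set_hausdorff (X : cantorSetType) : hausdorff_space X.
Proof.
have [f] := @cantor_setP X; rewrite open_hausdorff => x y xy.
have fxy : f x != f y by rewrite (inj_eq (can_inj (homeo_funK f))).
have := cantor_space_hausdorff; rewrite open_hausdorff.
move=> /(_ _ _ fxy)[[U V] [/= Ux Vy] [oU oV /eqP/seteqP[UV0 _]]].
have cf : continuous f := @homeo_fun_continuous _ _ f.
rewrite inE in Ux; rewrite inE in Vy.
exists (f @^-1` U, f @^-1` V) => /=; first by rewrite !inE.
split; [by apply: open_comp => // z _; exact: cf..|].
by apply/eqP/seteqP; split => // z [Uz Vz]; apply: (UV0 (f z)).
Qed.

Definition borel (X : ptopologicalType) := g_sigma_algebraType (@open X).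

(* The field [R] only serves to select the topology below, whose measures
   are [R]-valued. *)
Definition Homeo (R : realType) (X : cantorSetType) := homeomorphism X X.

Section uniform_topology.
Variables (R : realType) (X : cantorSetType).

HB.instance Definition _ := gen_eqMixin (Homeo R X).
HB.instance Definition _ := gen_choiceMixin (Homeo R X).
HB.instance Definition _ := isPointed.Build (Homeo R X) (idhomeo X).

Definition uniform_ball (T : Homeo R X) (mus : seq (probability (borel X) R))
    (eps : R) : set (Homeo R X) :=
  [set S | forall mu, mu \in mus -> (mu (differ S T) < eps%:E)%E].

Lemma differ_measurable (S T : Homeo R X) :
  measurable (differ S T : set (borel X)).
Proof.
apply: sub_sigma_algebra; apply: differ_open; exact: cantor_set_hausdorff.
Qed.

Lemma uniform_ball_center T mus eps : 0 < eps -> uniform_ball T mus eps T.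
Proof.
move=> e0 mu _; have -> : differ T T = set0.
  by apply/seteqP; split => x //=; rewrite /differ/= eqxx.
by rewrite measure0 lte_fin.
Qed.

Lemma uniform_ball_recenter T mus eps S : uniform_ball T mus eps S ->
  exists2 d, 0 < d & uniform_ball S mus d `<=` uniform_ball T mus eps.
Proof.
elim: mus => [|mu mus IH] TS; first by exists 1.
have [d d0 dP] : exists2 d, 0 < d &
    uniform_ball S mus d `<=` uniform_ball T mus eps.
  by apply: IH => nu nus; apply: TS; rewrite inE nus orbT.
have := TS mu (mem_head _ _).
have muE := fin_num_measure mu _ (differ_measurable S T).
rewrite -(fineK muE) lte_fin => muS.
exists (Num.min d (eps - fine (mu (differ S T)))).
  by rewrite lt_min d0 subr_gt0.
move=> U US nu; rewrite inE => /predU1P[->|nus]; last first.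
  apply: dP => // {}nu {}nus.
  have := US nu; rewrite inE nus orbT => /(_ isT) /lt_le_trans; apply.
  by rewrite lee_fin ge_min lexx.
apply: (@le_lt_trans _ _ (mu (differ U S) + mu (differ S T))%E).
  apply: (@le_trans _ _ (mu (differ U S `|` differ S T))).
    apply: le_measure; last exact: differ_triangle.
      by rewrite inE; exact: differ_measurable.
    by rewrite inE; apply: measurableU; exact: differ_measurable.
  by apply: measureU2; exact: differ_measurable.
have := US mu (mem_head _ _).
rewrite -(fineK muE) -lteBrDr// => /lt_le_trans; apply.
by rewrite -EFinB lee_fin ge_min lexx orbT.
Qed.

Record uniform_index := UniformIndex {
  ui_center : Homeo R X ;
  ui_measures : seq (probability (borel X) R) ;
  ui_radius : R }.

HB.instance Definition _ := gen_eqMixin uniform_index.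
HB.instance Definition _ := gen_choiceMixin uniform_index.
HB.instance Definition _ :=
  isPointed.Build uniform_index (UniformIndex point [::] 0).

Let D : set uniform_index := [set i | 0 < ui_radius i].
Let b i := uniform_ball (ui_center i) (ui_measures i) (ui_radius i).

Let b_cover : \bigcup_(i in D) b i = setT.
Proof.
apply/seteqP; split => // T _.
by exists (UniformIndex T [::] 1) => //=; rewrite /D/= ltr01.
Qed.

Let b_join i j T : D i -> D j -> b i T -> b j T ->
  exists k, [/\ D k, b k T & b k `<=` b i `&` b j].
Proof.
move=> _ _ /uniform_ball_recenter[d d0 di] /uniform_ball_recenter[e e0 ej].
pose k := UniformIndex T (ui_measures i ++ ui_measures j) (Num.min d e).
have k0 : D k by rewrite /D/= lt_min d0.
exists k; split => //; first exact: uniform_ball_center.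
move=> S kS; split; [apply: di|apply: ej] => mu mui;
  (have := kS mu; rewrite mem_cat mui ?orbT => /(_ isT) /lt_le_trans; apply);
  by rewrite lee_fin ge_min lexx ?orbT.
Qed.

HB.instance Definition _ :=
  isBaseTopological.Build (Homeo R X) b_cover b_join.

Lemma uniform_ball_open T mus eps : 0 < eps -> open (uniform_ball T mus eps).
Proof.
move=> e0; exists [set UniformIndex T mus eps] => [_ -> //|].
by rewrite bigcup_set1.
Qed.

Lemma uniform_basis : basis
  [set B | exists T mus eps, 0 < eps /\ B = uniform_ball T mus eps].
Proof.
split=> [_ [T [mus [e [e0 ->]]]]|T A]; first exact: uniform_ball_open.
rewrite nbhsE => -[_ [[D' D'D <-] [i D'i iT]] sA].
exists (b i); last by apply: subset_trans sA; exact: bigcup_sup.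
split => //; exists (ui_center i), (ui_measures i), (ui_radius i).
by split => //; exact: D'D.
Qed.

End uniform_topology.

(* Main.v *)
Require Import Defs.
From mathcomp Require Import all_boot all_order all_algebra.
From mathcomp Require Import all_classical all_reals.
From mathcomp Require Import topology measure cantor.
From mathcomp Require Import sequences.

Set Implicit Arguments.
Unset Strict Implicit.
Unset Printing Implicit Defensive.

Import Order.TTheory GRing.Theory Num.Theory.

Local Open Scope classical_set_scope.

(** Let [T] be a homeomorphism, [mus] finitely many probability measures and
    [e > 0]. The approximation of [T] is [S = T o h^-1 o g o h], where [h]
    identifies [X] with the space of binary sequences and [g] is an automorphism
    of the binary tree, acting on its boundary. Such a [g] is given by an
    arbitrary portrait [p], a set of words at which it flips the next letter, and
    [S] differs from [T] only at sequences having a prefix in [p].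

    Smallness. Halving a cylinder repeatedly yields a subcylinder that is as
    small as wished for all the measures at once ([small_cyl]). Doing so inside
    every cylinder gives a dense open union of cylinders of measure less than [e]
    ([small_cyl_seq]). Portraits are required to live in these cylinders, so that
    [S] is close to [T].

    Freeness. Pick a point [x] in each of the small cylinders; these points are
    dense. For a generic portrait, in the sense of Baire, each of them is
    aperiodic ([portrait_baire], [exists_aperiodic_perturb]): not returning to
    [x] within [n] steps is an open condition on the portrait
    ([no_return_open]), and it is dense ([no_return_dense]), because if [x] first
    returns at time [n.+1], then toggling the portrait at one long prefix of [x]
    changes the image of [x] but not that of the other points of its orbit, so
    that the same return becomes impossible. *)

(** * Prefixes and the topology of the Cantor space *)

Section prefixes.
Implicit Types x y : cantor_space.

(** The word formed by the first [n] letters of [x]. *)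
Definition pre x n : seq bool := mkseq x n.

Lemma size_pre x n : size (pre x n) = n.
Proof. exact: size_mkseq. Qed.

Lemma preS x n : pre x n.+1 = rcons (pre x n) (x n).
Proof. exact: mkseqS. Qed.

Lemma pre_take x m n : m <= n -> pre x m = take m (pre x n).
Proof.
by move=> mn; rewrite /pre /mkseq -map_take take_iota (minn_idPl mn).
Qed.

Lemma pre_le x y m n : m <= n -> pre x n = pre y n -> pre x m = pre y m.
Proof. by move=> mn e; rewrite (pre_take x mn) e -pre_take. Qed.

Lemma nth_pre x i n : i < n -> nth false (pre x n) i = x i.
Proof. exact: nth_mkseq. Qed.

Lemma pre_neq x y : x <> y -> exists n, pre x n <> pre y n.
Proof.
move=> xy; apply: contrapT => /forallNP e; apply: xy; apply/funext => i.
have /contrapT ei := e i.+1.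
by rewrite -(@nth_pre x i i.+1)// ei nth_pre.
Qed.

Lemma prefix_pre (v : seq bool) x n :
  prefix v (pre x n) -> pre x (size v) = v.
Proof.
move=> /[dup] /size_prefix; rewrite size_pre => vn.
by rewrite prefixE => /eqP ve; rewrite (pre_take x vn).
Qed.

Lemma open_pre n (w : seq bool) : open [set x | pre x n = w].
Proof.
rewrite openE => x /= xw.
suff : nbhs x [set y | pre y n = pre x n] by rewrite xw.
elim: n {xw} => [|n IH]; first by apply: filterS filterT => y _.
have nx : nbhs x [set y : cantor_space | y n = x n].
  apply: (@proj_continuous nat (fun=> bool) n x [set b | b = x n]).
  by apply: open_nbhs_nbhs; split => //; exact: discrete_open.
by apply: filterS (filterI IH nx) => y [/= e1 e2]; rewrite !preS e1 e2.
Qed.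

(** Cylinders form a neighbourhood basis: otherwise some sequence would agree
    with [x] on longer and longer prefixes, hence converge to [x], while avoiding
    a neighbourhood of [x]. *)
Lemma nbhs_pre x (U : set cantor_space) :
  nbhs x U -> exists n, forall y, pre y n = pre x n -> U y.
Proof.
move=> xU; apply: contrapT => /forallNP noU.
have /choice[u uP] n : exists y, pre y n = pre x n /\ ~ U y.
  by have /existsNP[y /not_implyP] := noU n; exists y.
have cu : u @ \oo --> x.
  apply/cvg_sup => i; apply/cvg_image.
    by apply/seteqP; split => // b _; exists (fun=> b).
  move=> V /= xV; have {}xV : V (x i) by apply: nbhs_singleton.
  exists [set y : cantor_space | V (y i)]; last first.
    by apply/seteqP; split => [_ [y Vy <-]//|b Vb]; exists (fun=> b).
  exists i.+1 => // n /= i_n.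
  by rewrite -(@nth_pre _ _ n)// (uP n).1 nth_pre.
by have [n _ /(_ n (leqnn n)) /=] := cu _ xU; apply: (uP n).2.
Qed.

(** Continuity of a map into the Cantor space is checked on prefixes. *)
Lemma continuous_pre (T : topologicalType) (f : T -> cantor_space) :
  (forall t n, \forall s \near t, pre (f s) n = pre (f t) n) -> continuous f.
Proof.
move=> fP t U /= /nbhs_pre[n nU].
by apply: filterS (fP t n) => s /nU.
Qed.

Lemma nearby_pre x n : \forall y \near x, pre y n = pre x n.
Proof. by apply: open_nbhs_nbhs; split => //; exact: open_pre. Qed.

End prefixes.

(** * Portraits and tree automorphisms *)

Section portraits.
Implicit Types (p q : seq bool -> bool) (x y : cantor_space).

(** The automorphism of the binary tree with portrait [p], acting on the
    boundary: the [n]-th letter of [x] is flipped when [p] holds at the prefix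
    of length [n] of [x]. *)
Definition tree_aut p x : cantor_space := fun n => x n (+) p (pre x n).

(** The prefix of length [n] of the preimage of [y]. *)
Fixpoint tree_inv_pre p y n : seq bool :=
  if n is n'.+1 then
    let w := tree_inv_pre p y n' in rcons w (y n' (+) p w)
  else [::].

(** The inverse of [tree_aut p]. *)
Definition tree_aut_inv p y : cantor_space :=
  fun n => y n (+) p (tree_inv_pre p y n).

Lemma pre_tree_aut_inv p y n : pre (tree_aut_inv p y) n = tree_inv_pre p y n.
Proof. by elim: n => // n IH; rewrite preS IH. Qed.

Lemma tree_inv_preK p x n : tree_inv_pre p (tree_aut p x) n = pre x n.
Proof. by elim: n => // n IH; rewrite preS /= IH /tree_aut addbK. Qed.

Lemma tree_autK p : cancel (tree_aut p) (tree_aut_inv p).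
Proof.
by move=> x; apply/funext => n; rewrite /tree_aut_inv tree_inv_preK addbK.
Qed.

Lemma tree_aut_invK p : cancel (tree_aut_inv p) (tree_aut p).
Proof.
by move=> y; apply/funext => n; rewrite /tree_aut pre_tree_aut_inv addbK.
Qed.

(** Two portraits agree up to level [m] when they coincide on the words of
    length less than [m]. *)
Definition agree m p q := forall w : seq bool, size w < m -> p w = q w.

Lemma agree_trans m p q r : agree m p q -> agree m q r -> agree m p r.
Proof. by move=> pq qr w wm; rewrite pq ?qr. Qed.

Lemma agree_le m n p q : m <= n -> agree n p q -> agree m p q.
Proof. by move=> mn pq w wm; apply: pq; exact: leq_trans mn. Qed.

Lemma pre_tree_aut p q x y n : agree n p q -> pre x n = pre y n ->
  pre (tree_aut p x) n = pre (tree_aut q y) n.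
Proof.
elim: n => // n IH pq xy; have xyn := pre_le (leqnSn n) xy.
rewrite !preS (IH (agree_le (leqnSn n) pq) xyn) /tree_aut xyn pq ?size_pre//.
by rewrite -(@nth_pre x n n.+1)// xy nth_pre.
Qed.

Lemma tree_aut_continuous p : continuous (tree_aut p).
Proof.
apply: continuous_pre => x n; apply: filterS (nearby_pre x n) => y.
exact: pre_tree_aut.
Qed.

Lemma tree_aut_inv_continuous p : continuous (tree_aut_inv p).
Proof.
apply: continuous_pre => x n; apply: filterS (nearby_pre x n) => y.
rewrite !pre_tree_aut_inv; elim: n => // n IH xy /=.
rewrite (IH (pre_le (leqnSn n) xy)).
by rewrite -(@nth_pre x n n.+1)// -xy nth_pre.
Qed.

Definition tree_homeo p : homeomorphism cantor_space cantor_space :=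
  Homeomorphism (@tree_autK p) (@tree_aut_invK p) (@tree_aut_continuous p)
    (@tree_aut_inv_continuous p).

Lemma tree_aut_fixed p x : (forall n, ~~ p (pre x n)) -> tree_aut p x = x.
Proof.
by move=> px; apply/funext => n; rewrite /tree_aut (negbTE (px n)) addbF.
Qed.

(** A portrait is supported in [A] when it only flips at words of [A]. *)
Definition supported (A : set (seq bool)) p := forall w, p w -> A w.

(** The Baire category theorem for portraits supported in [A]: countably many
    conditions, each of them open and dense for agreement up to a level, can be
    met at once. *)
Lemma portrait_baire (A : set (seq bool)) (I : countType)
    (Q : I -> (seq bool -> bool) -> Prop) :
  (forall i p, Q i p -> exists m, forall q, agree m p q -> Q i q) ->
  (forall i p m, supported A p ->
    exists q, [/\ supported A q, agree m p q & Q i q]) ->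
  exists2 p, supported A p & forall i, Q i p.
Proof.
move=> Qopen Qdense.
(* The conditions are enumerated; a number that encodes no element of [I]
   imposes nothing. *)
pose Q' k p := if unpickle k is Some i then Q i p else True.
(* A stage is a portrait and a level below which it is no longer modified. *)
have step (s : nat * ((seq bool -> bool) * nat)) :
  exists t : (seq bool -> bool) * nat, supported A s.2.1 ->
    [/\ supported A t.1, agree s.2.2 s.2.1 t.1, s.2.2 < t.2 &
        forall r, agree t.2 t.1 r -> Q' s.1 r].
  case: s => k [p m] /=; rewrite /Q'.
  have [pA|npA] := pselect (supported A p); last by exists (p, m).
  case: (unpickle k) => [i|]; last by exists (p, m.+1).
  have [q [qA pq /Qopen[m' m'Q]]] := Qdense i p m pA.
  exists (q, maxn m.+1 m') => _; split => //=; first by rewrite leq_maxl.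
  by move=> r qr; apply: m'Q; apply: agree_le qr; exact: leq_maxr.
have [f fP] := choice step.
pose s := fix s k : (seq bool -> bool) * nat :=
  if k is k'.+1 then f (k', s k') else (xpred0, 0).
have sA k : supported A (s k).1.
  by elim: k => [//|k IH]; have [] := fP (k, s k) IH.
have sP k := fP (k, s k) (sA k).
have s_ge k : k <= (s k).2.
  by elim: k => // k IH; have [_ _ lt _] := sP k; exact: leq_trans lt.
have s_mono k d : (s k).2 <= (s (k + d)).2.
  elim: d => [|d IH]; first by rewrite addn0.
  by rewrite addnS; have [_ _ /ltnW le _] := sP (k + d); exact: leq_trans le.
have s_agree k d : agree (s k).2 (s k).1 (s (k + d)).1.
  elim: d => [|d IH]; first by rewrite addn0.
  rewrite addnS; apply: agree_trans IH _.
  by have [_ ag _ _] := sP (k + d); exact: agree_le (s_mono k d) ag.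
(* The level at stage [k] is at least [k], so that the value at a word of
   length [n] is final from stage [n.+1] on. *)
pose lim_p w := (s (size w).+1).1 w.
have lim_agree k : agree (s k).2 (s k).1 lim_p.
  move=> w wk; rewrite /lim_p; have [le|/ltnW le] := leqP k (size w).+1.
    by rewrite -(subnKC le); exact: s_agree.
  by rewrite -(subnKC le); apply/esym/s_agree; exact: s_ge.
exists lim_p => [w|i]; first exact: sA.
have [_ _ _ /(_ lim_p (lim_agree (pickle i).+1))] := sP (pickle i).
by rewrite /Q' pickleK.
Qed.

End portraits.

(** * Aperiodicity of generic perturbations *)

Section generic.
Variable T : cantor_space -> cantor_space.
Variables (Tinj : injective T) (Tcont : continuous T).
Implicit Types (p q : seq bool -> bool) (x y : cantor_space).

(** The map [T] perturbed by a tree automorphism. *)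
Definition perturb p x := T (tree_aut p x).

Lemma iter_perturb_inj p n : injective (iter n (perturb p)).
Proof.
by elim: n => // n IH x y /= /Tinj /(can_inj (@tree_autK p)) /IH.
Qed.

(** The iterates of a point depend continuously on the portrait. *)
Lemma iter_perturb_agree p x i m : exists M, forall q, agree M p q ->
  pre (iter i (perturb q) x) m = pre (iter i (perturb p) x) m.
Proof.
elim: i m => [|i IH] m; first by exists 0.
have /nbhs_pre[n nP] := Tcont (nearby_pre (perturb p (iter i (perturb p) x)) m).
have [M MP] := IH n.
exists (maxn M n) => q pq; apply: nP; apply/esym/pre_tree_aut.
  by apply: agree_le pq; exact: leq_maxr.
by rewrite MP//; apply: agree_le pq; exact: leq_maxl.
Qed.

(** [x] does not come back to itself within [n] iterations. *)
Definition no_return n x p :=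
  forall j, 0 < j <= n -> iter j (perturb p) x <> x.

Lemma no_return_open n x p : no_return n x p ->
  exists m, forall q, agree m p q -> no_return n x q.
Proof.
elim: n => [|n IH] pn; first by exists 0 => q _ [|j].
have [|m mP] := IH; first by move=> j /andP[j0 jn]; apply: pn; rewrite j0 ltnW.
have [k kP] := pre_neq (pn n.+1 (ltnSn n)).
have [M MP] := iter_perturb_agree p x n.+1 k.
exists (maxn m M) => q pq j /andP[j0]; rewrite leq_eqVlt => /predU1P[->|jn].
  move=> e; apply: kP; rewrite -(MP q) ?e//.
  by apply: agree_le pq; exact: leq_maxr.
by apply: mP; [apply: agree_le pq; exact: leq_maxl|rewrite j0].
Qed.

(** If [x] first returns at time [n.+1], flipping the portrait at a prefix of
    [x] long enough to avoid the other points of the orbit moves the image of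
    [x] and nothing else on the orbit, which breaks the return. *)
Lemma no_return_dense (A : set (seq bool)) x l n p m :
  (forall k, l <= k -> A (pre x k)) -> supported A p ->
  exists q, [/\ supported A q, agree m p q & no_return n x q].
Proof.
move=> xA pA; elim: n => [|n [q [qA pq qn]]].
  by exists p; split => // -[|j].
have [xn|xn] := pselect (iter n.+1 (perturb q) x = x); last first.
  exists q; split => // j /andP[j0]; rewrite leq_eqVlt => /predU1P[->//|jn].
  by apply: qn; rewrite j0.
have [m1 m1P] := no_return_open qn.
have [m2 m2P] : exists k, forall j, 0 < j <= n ->
    pre (iter j (perturb q) x) k <> pre x k.
  have /choice[k kP] j : exists k, 0 < j <= n ->
      pre (iter j (perturb q) x) k <> pre x k.
    have [jn|jn] := boolP (0 < j <= n); last by exists 0.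
    by have [k] := pre_neq (qn j jn); exists k.
  exists (\max_(j < n.+1) k j) => j jn /pre_le e.
  have jn1 : j < n.+1 by case/andP: jn.
  by apply: (kP j jn); apply: e; exact: (leq_bigmax (Ordinal jn1)).
have [M [mM m1M m2M lM]] : exists M, [/\ m <= M, m1 <= M, m2 <= M & l <= M].
  by exists (maxn (maxn m m1) (maxn m2 l)); rewrite !leq_max !leqnn !orbT.
(* The level [M] is beyond all those that matter; [r] is [q] flipped at the
   prefix of [x] of length [M]. *)
pose r w := q w (+) (w == pre x M).
have qr k : k <= M -> agree k q r.
  move=> kM w wk; rewrite /r; case: eqP => [e|_]; last by rewrite addbF.
  by move: wk; rewrite e size_pre ltnNge kM.
have r_eq y : pre y M <> pre x M -> perturb r y = perturb q y.
  move=> yx; congr T; apply/funext => i; rewrite /tree_aut /r.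
  case: eqP => [e|_]; last by rewrite addbF.
  have iM : i = M by rewrite -(size_pre y i) e size_pre.
  by case: yx; rewrite -[in LHS]iM.
exists r; split.
- move=> w; rewrite /r; case: eqP => [->|_]; last by rewrite addbF; exact: qA.
  by move=> _; exact: xA.
- exact: agree_trans pq (qr _ mM).
have rn : no_return n x r by apply: m1P; exact: qr.
move=> j /andP[j0]; rewrite leq_eqVlt => /predU1P[->|jn]; last first.
  by apply: rn; rewrite j0.
move=> xr.
(* Both [perturb q x] and [perturb r x] reach [x] after [n] iterations of
   [perturb r]; by injectivity they are equal, which the flip at level [M]
   forbids. *)
have follow i : i <= n ->
    iter i (perturb r) (perturb q x) = iter i.+1 (perturb q) x.
  elim: i => [//|i IH] i_n; rewrite iterS IH 1?ltnW// r_eq//.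
  by move=> /(pre_le m2M); exact: m2P.
have /iter_perturb_inj/Tinj/(congr1 (@^~ M)) :
    iter n (perturb r) (perturb r x) = iter n (perturb r) (perturb q x).
  by rewrite -iterSr xr follow.
by rewrite /tree_aut /r eqxx addbA addbT; case: (_ (+) _).
Qed.

(** If all long prefixes of each [D k] lie in [A], then some portrait supported
    in [A] makes all the points [D k] aperiodic for the perturbed map. *)
Lemma exists_aperiodic_perturb (A : set (seq bool)) (D : nat -> cantor_space) :
  (forall k, exists l, forall n, l <= n -> A (pre (D k) n)) ->
  exists2 p, supported A p &
    forall k n, 0 < n -> iter n (perturb p) (D k) <> D k.
Proof.
move=> DA.
have [|[k n] p m pA|p pA pQ] :=
    @portrait_baire A (nat * nat)%type (fun i => no_return i.2 (D i.1)).
- by move=> i p; exact: no_return_open.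
- by have [l lP] := DA k; exact: no_return_dense lP pA.
- by exists p => // k n n0; apply: (pQ (k, n)); rewrite n0 leqnn.
Qed.

End generic.

(** * Small dense families of cylinders *)

Local Open Scope ring_scope.

(** A nonnegative finitely additive mass on the binary tree takes arbitrarily
    small values below every word: one of the two halves has at most half of the mass. *)
Lemma word_halving (R : realType) (m : seq bool -> R) (e : R) (w : seq bool) :
  (forall v, 0 <= m v) ->
  (forall v, m v = m (rcons v false) + m (rcons v true)) ->
  0 < e -> exists2 v, prefix w v & m v < e.
Proof.
move=> m0 mD e0.
have [n mn] : exists n, m w < e * 2 ^+ n.
  have [n en] : exists n, m w / e < n%:R.
    exists (Num.truncn (m w / e)).+1; apply: truncnS_gt.
  exists n; rewrite mulrC -ltr_pdivrMr//; apply: lt_le_trans en _.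
  by rewrite -natrX ler_nat ltnW// ltn_expl.
elim: n w mn => [|n IH] w mn.
  by exists w; rewrite ?prefix_refl// -[e]mulr1.
suff [b /IH[v wv ve]] : exists b, m (rcons w b) < e * 2 ^+ n.
  by exists v => //; apply: prefix_trans wv; exact: prefix_rcons.
move: mn; rewrite mD exprS mulrCA mulr_natl mulr2n => mn.
have [lt|ge] := ltP (m (rcons w false)) (e * 2 ^+ n); first by exists false.
by exists true; rewrite ltNge; apply/negP => ge'; move: mn; rewrite ltNge lerD.
Qed.

Section small_cylinders.
Variables (R : realType) (X : cantorSetType).
Variable h : homeomorphism X cantor_space.
Implicit Types (mu : probability (borel X) R) (w : seq bool).

(** The cylinder of a word, transported to [X]. *)
Definition cyl w : set (borel X) := [set x | pre (h x) (size w) = w].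

Lemma measurable_cyl w : measurable (cyl w).
Proof.
apply: sub_sigma_algebra.
apply: (@open_comp _ _ h [set y | pre y (size w) = w]); last exact: open_pre.
by move=> x _; exact: homeo_fun_continuous.
Qed.

Lemma cyl_rcons w : cyl w = cyl (rcons w false) `|` cyl (rcons w true).
Proof.
apply/seteqP; split => [x|x].
  rewrite /cyl/= !size_rcons !preS => ->.
  by case: (h x (size w)); [right|left].
by rewrite /cyl/= !size_rcons !preS => -[] /rcons_inj[].
Qed.

Lemma measure_cyl_rcons mu w :
  fine (mu (cyl w)) =
  fine (mu (cyl (rcons w false))) + fine (mu (cyl (rcons w true))).
Proof.
rewrite -fineD; [|exact: (fin_num_measure _ _ (measurable_cyl _))..].
rewrite -measureU; [by rewrite -cyl_rcons|exact: measurable_cyl..|].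
apply/seteqP; split => // x []; rewrite /cyl/= !size_rcons => ->.
by case/rcons_inj.
Qed.

(** Every cylinder contains one that is small for finitely many measures. *)
Lemma small_cyl (mus : seq (probability (borel X) R)) w (e : R) : 0 < e ->
  exists2 v, prefix w v & forall mu, mu \in mus -> (mu (cyl v) < e%:E)%E.
Proof.
move=> e0; pose m v := \sum_(mu <- mus) fine (mu (cyl v)).
have [||v wv mv] := @word_halving R m e w _ _ e0.
- by move=> v; apply: sumr_ge0 => mu _; exact: fine_ge0.
- move=> v; rewrite -big_split; apply: eq_bigr => mu _.
  exact: measure_cyl_rcons.
exists v => // mu mui.
rewrite -[mu _]fineK ?lte_fin; last first.
  exact: (fin_num_measure _ _ (measurable_cyl _)).
apply: le_lt_trans mv; rewrite /m (big_rem mu)//= lerDl.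
by apply: sumr_ge0 => nu _; exact: fine_ge0.
Qed.

(** One can choose a cylinder inside every cylinder so that the union of the
    chosen ones is small for finitely many measures. *)
Lemma small_cyl_seq (mus : seq (probability (borel X) R)) (e : R) : 0 < e ->
  exists v : nat -> seq bool,
    (forall w, exists k, prefix w (v k)) /\
    (forall mu, mu \in mus -> (mu (\bigcup_k cyl (v k)) < e%:E)%E).
Proof.
move=> e0.
have /choice[v vP] k : exists v : seq bool, prefix (odflt [::] (unpickle k)) v /\
    forall mu, mu \in mus -> (mu (cyl v) < (e / 2 / (2 ^ k.+1)%:R)%:E)%E.
  have ek : 0 < e / 2 / (2 ^ k.+1)%:R.
    by rewrite !divr_gt0// ltr0n expn_gt0.
  by have [v] := small_cyl mus (odflt [::] (unpickle k)) ek; exists v.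
exists v; split => [w|mu mui].
  by exists (pickle w); have [] := vP (pickle w); rewrite pickleK.
have e20 : 0 <= e / 2 by rewrite divr_ge0// ltW.
(* Half of [e] is kept to turn the bound on the sum into a strict one. *)
apply: (@le_lt_trans _ _ (e / 2)%:E); last first.
  by rewrite lte_fin ltr_pdivrMr// ltr_pMr// ltr1n.
have mv k : measurable (cyl (v k)) := measurable_cyl (v k).
have := generalized_Boole_inequality mu mv (bigcupT_measurable _ mv).
move=> /le_trans; apply; apply: le_trans (epsilon_trick0 xpredT e20).
apply: lee_nneseries => k _; first by move=> _; exact: measure_ge0.
exact/ltW/(vP k).2.
Qed.

End small_cylinders.

(** * Density of topologically free homeomorphisms *)

Definition comp_homeo (X Y Z : topologicalType) (g : homeomorphism Y Z)
    (f : homeomorphism X Y) : homeomorphism X Z :=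
  @Homeomorphism X Z (g \o f) (homeo_inv f \o homeo_inv g)
    (can_comp (homeo_funK g) (homeo_funK f))
    (can_comp (homeo_invK f) (homeo_invK g))
    (fun x => continuous_comp (@homeo_fun_continuous _ _ f x)
                              (@homeo_fun_continuous _ _ g (f x)))
    (fun z => continuous_comp (@homeo_inv_continuous _ _ g z)
                              (@homeo_inv_continuous _ _ f (homeo_inv g z))).

Definition inv_homeo (X Y : topologicalType) (f : homeomorphism X Y) :
    homeomorphism Y X :=
  Homeomorphism (homeo_invK f) (homeo_funK f)
    (@homeo_inv_continuous _ _ f) (@homeo_fun_continuous _ _ f).

(** A point is aperiodic as soon as its forward orbit never returns to it. *)
Lemma aperiodic_iter (X : topologicalType) (S : homeomorphism X X) x :
  (forall n, (0 < n)%N -> iter n S x <> x) -> aperiodic S x.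
Proof.
move=> Sx [[//|n] _|n _]; apply/eqP; first exact: (Sx n.+1).
have iterK k : cancel (iter k (homeo_inv S)) (iter k S).
  by elim: k => // k IH y; rewrite iterSr iterS homeo_invK IH.
move=> /= e; apply: (Sx n.+1) => //.
by rewrite -[in LHS]e -iterS iterK.
Qed.

(** Every ball of the uniform topology contains a topologically free
    homeomorphism. *)
Lemma topologically_free_approx (R : realType) (X : cantorSetType)
    (T : Homeo R X) (mus : seq (probability (borel X) R)) (e : R) : 0 < e ->
  exists2 S : Homeo R X, topologically_free S & uniform_ball T mus e S.
Proof.
move=> e0; have [h] := @cantor_setP X.
have [v [vdense vsmall]] := small_cyl_seq h mus e0.
pose A : set (seq bool) := [set u | exists k, prefix (v k) u].
(* [D k] is the word [v k] followed by zeros. *)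
pose D k : cantor_space := nth false (v k).
have preD k n : (size (v k) <= n)%N -> prefix (v k) (pre (D k) n).
  move=> kn; rewrite prefixE -pre_take//; apply/eqP.
  by rewrite -[RHS](mkseq_nth false).
(* [T'] is [T] read in the Cantor space. *)
pose T' := comp_homeo h (comp_homeo T (inv_homeo h)).
have T'inj : injective T' := can_inj (homeo_funK T').
have T'cont : continuous T' := @homeo_fun_continuous _ _ T'.
have [|p pA pD] := exists_aperiodic_perturb T'inj T'cont (A := A) (D := D).
  by move=> k; exists (size (v k)) => n kn; exists k; exact: preD.
pose S := comp_homeo T (comp_homeo (inv_homeo h) (comp_homeo (tree_homeo p) h)).
exists S.
  have hS y n : h (iter n S (homeo_inv h y)) = iter n (perturb T' p) y.
    elim: n => [|n IH] /=; first exact: homeo_invK.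
    by rewrite IH.
  move=> O [x Ox] oO.
  have : nbhs (h x) (homeo_inv h @^-1` O).
    apply: (@homeo_inv_continuous _ _ h (h x) O); rewrite homeo_funK.
    exact: open_nbhs_nbhs.
  move=> /nbhs_pre[n nO]; have [k kP] := vdense (pre (h x) n).
  exists (homeo_inv h (D k)); split.
    apply: nO; have := preD k (maxn n (size (v k))) (leq_maxr _ _).
    by move=> /(prefix_trans kP)/prefix_pre; rewrite size_pre.
  apply: aperiodic_iter => j j0 /(congr1 h); rewrite hS homeo_invK.
  exact: pD.
move=> mu mui; apply: le_lt_trans (vsmall mu mui).
apply: le_measure; rewrite ?inE; first exact: differ_measurable.
  by apply: bigcupT_measurable => k; exact: measurable_cyl.
move=> x /eqP Sx; apply: contrapT => xv; apply: Sx => /=.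
congr (T _); rewrite -[RHS](homeo_funK h); congr (homeo_inv h _).
apply: tree_aut_fixed => n; apply/negP => /pA[k /prefix_pre vk].
by apply: xv; exists k.
Qed.

Theorem theorem2p8 (R : realType) (X : cantorSetType) :
  dense [set T : Homeo R X | topologically_free T].
Proof.
move=> O [T OT] oO.
have [_ /(_ T O (open_nbhs_nbhs (conj oO OT)))] := uniform_basis R X.
move=> [_ [[T0 [mus [e [e0 ->]]]] T0T] sub].
have [d d0 ballO] := uniform_ball_recenter T0T.
have [S Sfree ST] := topologically_free_approx T mus d0.
by exists S; split => //; exact/sub/ballO.
Qed.
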